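(* Let $f\in C[-1,1]$ be a function that is not identically zero. For $n\in\mathbb N$ let $E_n(f)=\min_{P\in\mathcal P_n}\|f-P\|_{[-1,1]}$, where $\mathcal P_n$ is the space of algebraic polynomials of degree at most $n$ and $\|\cdot\|_{[-1,1]}$ is the uniform norm on $[-1,1]$, and let $E_n^*(f)=\max\bigl(E_n(f),e^{-n}\bigr)$. For $t>0$ let $m_f(t)=\bigl|\{x\in[-1,1]:|f(x)|\le t\}\bigr|$ (Lebesgue measure). Suppose there exist $\beta>0$ and a subsequence $\{n_j\}\subset\mathbb N$ with $$\lim_{j\to\infty}\frac{n_{j+1}}{n_j}=+\infty$$ such that $E_{n_j}(f)\le e^{-\beta n_j}$ for all $j$. Then $$\lim_{j\to\infty}\frac{|\log m_f(E^*_{n_{j+1}}(f))|}{|\log m_f(E^*_{n_j}(f))|}=+\infty.$$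
   Context: Such functions (satisfying $E_{n_j}(f)\le e^{-\beta n_j}$ along a subsequence) are called Bernstein quasianalytic functions.
   Formalization: If f has no zeros the ratio is undefined (log 0 over log 0, e.g. f = e^x); the limit is proved in the form: for every M > 0, eventually M·|log m_f(E*_{n_j})| ≤ |log m_f(E*_{n_{j+1}})|, with |log 0| = +∞. *)

(* Defs.v *)
From HB Require Import structures.
From mathcomp Require Import all_boot all_order all_algebra.
From mathcomp Require Import all_classical all_reals all_analysis.
Set Implicit Arguments. Unset Strict Implicit. Unset Printing Implicit Defensive.
Import Order.TTheory GRing.Theory Num.Theory.
Import numFieldNormedType.Exports.
Local Open Scope classical_set_scope.
Local Open Scope ring_scope.

Definition supnorm11 {R : realType} (g : R -> R) : R :=
  sup [set `|g x| | x in `[-1, 1]%classic].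

(* E_n(f) : distance from f to polynomials of degree <= n (the min is attained,
   so it equals this infimum) *)
Definition bestapprox {R : realType} (f : R -> R) (n : nat) : R :=
  inf [set supnorm11 (fun x => f x - P.[x]) | P in [set P : {poly R} | (size P <= n.+1)%N]].

Definition bestapprox_star {R : realType} (f : R -> R) (n : nat) : R :=
  Num.max (bestapprox f n) (expR (- n%:R)).

Definition distrib_m {R : realType} (f : R -> R) (t : R) : \bar R :=
  lebesgue_measure ([set x | `|f x| <= t] `&` `[-1, 1]%classic).

(* |log m| as an extended real, with the convention |log 0| = +oo *)
Definition abslog {R : realType} (m : \bar R) : \bar R :=
  if m == 0%E then +oo%E else (`|ln (fine m)|)%:E.

(* Main.v *)
Require Import Defs.
From HB Require Import structures.
From mathcomp Require Import all_boot all_order all_algebra.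
From mathcomp Require Import all_classical all_reals all_analysis.
From mathcomp Require Import measurable_realfun.
From mathcomp Require Import ring lra zify.
Import Order.TTheory GRing.Theory Num.Theory.
Import numFieldNormedType.Exports.
Local Open Scope classical_set_scope.
Local Open Scope ring_scope.

(* Let kappa = min (beta, 1) and m(t) = |{|f| <= t}|. It suffices to bound m(E*_(n_j)) below by
   a small power of delta = m(E*_(n_(j+1))), once m(E*_(n_j)) is known to tend to 0.

   Write N = n_(j+1), and let P have degree N with |f - P| <= 2 exp(-kappa N). Expanding P in
   Chebyshev polynomials bounds the Taylor coefficients of P at any point of [-1, 1] by
   exp(sigma N) rho^(-i), with sigma arbitrarily small when rho is small. The set
   {|f| <= E*_N} fills a proportion delta/2 of some interval J of length about delta^theta.
   Interpolating P at
   m ~ sigma N / (theta log (1/delta)) well spaced points of that set in J, the Lagrange part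
   is at most (C/delta)^(m-1) exp(-kappa N) and the remainder at most
   exp(sigma N) (C |J| / rho)^m. Hence |f| <= exp(-sigma N) on all of J, which is at most
   exp(-n_j) because N / n_j is large, so m(E*_(n_j)) >= |J|.

   The same local estimate, with a fixed density, shows that f vanishing on a set of positive
   measure would vanish on an interval, then on neighbouring intervals, hence everywhere; so
   m(E*_(n_j)) tends to |{f = 0}| = 0. *)

(** * Absolute coefficient sums and Newton interpolation *)

(** A majorant of [|p|] on the disc of radius [t]. For a polynomial recentred at [c] it controls all
    Taylor coefficients at [c] at once. *)
Definition cnorm {R : realType} (t : R) (p : {poly R}) : R :=
  \sum_(i < size p) `|p`_i| * t ^+ i.

Lemma cnorm_widen (R : realType) (t : R) (p : {poly R}) (n : nat) :
  (size p <= n)%N -> cnorm t p = \sum_(i < n) `|p`_i| * t ^+ i.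
Proof.
move=> pn; rewrite /cnorm (big_ord_widen n (fun i => `|p`_i| * t ^+ i)) //.
rewrite big_mkcond /=; apply: eq_bigr => i _; case: ltnP => // pi.
by rewrite nth_default // normr0 mul0r.
Qed.

Lemma cnorm_ge0 (R : realType) (t : R) (p : {poly R}) : 0 <= t -> 0 <= cnorm t p.
Proof. by move=> t0; apply: sumr_ge0 => i _; rewrite mulr_ge0 ?exprn_ge0. Qed.

Lemma cnorm0 (R : realType) (t : R) : cnorm t 0 = 0.
Proof. by rewrite /cnorm size_poly0 big_ord0. Qed.

Lemma cnormD (R : realType) (t : R) (p q : {poly R}) :
  0 <= t -> cnorm t (p + q) <= cnorm t p + cnorm t q.
Proof.
move=> t0; pose n := maxn (size p) (size q).
rewrite (@cnorm_widen _ _ (p + q) n) ?size_polyD //.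
rewrite (@cnorm_widen _ _ p n) ?leq_maxl // (@cnorm_widen _ _ q n) ?leq_maxr //.
rewrite -big_split /=; apply: ler_sum => i _.
by rewrite -mulrDl coefD ler_wpM2r ?exprn_ge0 ?ler_normD.
Qed.

Lemma cnormZ (R : realType) (t a : R) (p : {poly R}) :
  cnorm t (a *: p) = `|a| * cnorm t p.
Proof.
rewrite (@cnorm_widen _ _ (a *: p) (size p)) ?size_scale_leq // /cnorm mulr_sumr.
by apply: eq_bigr => i _; rewrite coefZ normrM mulrA.
Qed.

Lemma cnorm_MXaddC (R : realType) (t c : R) (p : {poly R}) :
  cnorm t (p * 'X + c%:P) = t * cnorm t p + `|c|.
Proof.
rewrite (@cnorm_widen _ _ _ (size p).+1); last by rewrite size_MXaddC; case: ifP.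
rewrite big_ord_recl coefD coefMX coefC /= expr0 mulr1 add0r addrC; congr (_ + _).
rewrite /cnorm mulr_sumr; apply: eq_bigr => i _.
by rewrite coefD coefMX coefC /= addr0 exprS mulrCA.
Qed.

Lemma cnormC (R : realType) (t c : R) : cnorm t c%:P = `|c|.
Proof. by rewrite -[c%:P]add0r -[X in X + _](mul0r 'X) cnorm_MXaddC cnorm0 mulr0 add0r. Qed.

Lemma cnormMX (R : realType) (t : R) (p : {poly R}) : cnorm t (p * 'X) = t * cnorm t p.
Proof. by rewrite -[p * 'X]addr0 -[X in _ + X]polyC0 cnorm_MXaddC normr0 addr0. Qed.

Lemma cnorm_sum (R : realType) (t : R) (n : nat) (F : nat -> {poly R}) :
  0 <= t -> cnorm t (\sum_(i < n) F i) <= \sum_(i < n) cnorm t (F i).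
Proof.
move=> t0; elim: n => [|n IH]; first by rewrite !big_ord0 cnorm0.
rewrite !big_ord_recr /=; apply: le_trans (cnormD _ _ _ _ t0) _.
by rewrite lerD2r.
Qed.

Lemma horner_le_cnorm (R : realType) (t y : R) (p : {poly R}) :
  `|y| <= t -> `|p.[y]| <= cnorm t p.
Proof.
move=> yt; rewrite horner_coef; apply: le_trans (ler_norm_sum _ _ _) _.
apply: ler_sum => i _; rewrite normrM normrX ler_wpM2l //.
by rewrite lerXn2r // ?nnegrE // (le_trans _ yt).
Qed.

(** Horner's scheme. The extra term [cnorm |a| p] closes the induction: it dominates the value at
    [a] of the shorter polynomial, which is the new coefficient of the quotient. *)
Lemma cnorm_factor (R : realType) (t a : R) (p : {poly R}) : `|a| <= t ->
  exists2 h : {poly R}, p = (p.[a])%:P + h * ('X - a%:P) &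
    (t - `|a|) * cnorm t h + cnorm `|a| p <= cnorm t p.
Proof.
move=> at_; elim/poly_ind: p => [|p c [h ph hb]].
  by exists 0; rewrite ?horner0 ?mul0r ?addr0 ?cnorm0 ?mulr0 ?addr0.
exists (h * 'X + (p.[a])%:P).
  rewrite {1}ph hornerMXaddC polyCD polyCM; ring.
rewrite !cnorm_MXaddC.
have t0 : 0 <= t by apply: le_trans at_.
have pa : `|p.[a]| <= cnorm `|a| p by apply: horner_le_cnorm.
have h1 := ler_wpM2l t0 hb.
have st : 0 <= t - `|a| by rewrite subr_ge0.
have h2 := ler_wpM2l st pa.
rewrite -subr_ge0 in h1; rewrite -subr_ge0 in h2.
rewrite -subr_ge0; apply: le_trans (addr_ge0 h1 h2) _.
by rewrite le_eqVlt; apply/orP; left; apply/eqP; ring.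
Qed.

(** Divide by ['X - x i] for one node after the other, each division costing a factor [t - s]. [L]
    is the Newton interpolant and [h] the quotient of the remainder term. *)
Lemma cnorm_newton (R : realType) (t s : R) (p : {poly R}) (x : nat -> R) (m : nat) :
  0 <= s -> s < t -> (forall i, (i < m)%N -> `|x i| <= s) ->
  exists L h : {poly R}, [/\ (size L <= m)%N,
    p = L + h * \prod_(i < m) ('X - (x i)%:P) &
    (t - s) ^+ m * cnorm t h <= cnorm t p].
Proof.
move=> s0 st; elim: m => [|m IH] xs.
  by exists 0, p; rewrite size_poly0 big_ord0 add0r mulr1 expr0 mul1r.
have [|L [h [sL pE hb]]] := IH; first by move=> i im; apply: xs; exact: leqW.
have xm := xs m (ltnSn m).
have xt : `|x m| <= t by apply: le_trans xm (ltW st).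
have [g hE gb] := @cnorm_factor _ t (x m) h xt.
exists (L + (h.[x m])%:P * \prod_(i < m) ('X - (x i)%:P)), g; split.
- apply: leq_trans (size_polyD _ _) _; rewrite geq_max (leqW sL) /=.
  rewrite mul_polyC; apply: leq_trans (size_scale_leq _ _) _.
  by rewrite (size_prod_XsubC (index_enum 'I_m) (fun i => x i)) /index_enum -enumT size_enum_ord.
- by rewrite {1}pE {1}hE big_ord_recr /=; ring.
- apply: le_trans hb; rewrite exprSr -mulrA ler_wpM2l ?exprn_ge0 ?subr_ge0 ?(ltW st) //.
  apply: le_trans _ gb; rewrite -[leLHS]addr0 lerD ?cnorm_ge0 //.
  by rewrite ler_wpM2r ?cnorm_ge0 ?(le_trans s0 (ltW st)) // lerD2l lerN2.
Qed.

(** * Taylor coefficients of bounded polynomials *)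

(* The pair (T_k, U_(k-1)) of Chebyshev polynomials, by the angle addition formulas. *)
Fixpoint cheb {R : realType} (k : nat) : {poly R} * {poly R} :=
  if k is k'.+1 then
    ('X * (cheb k').1 - (1 - 'X ^+ 2) * (cheb k').2, 'X * (cheb k').2 + (cheb k').1)
  else (1, 0).

Lemma cheb_cos (R : realType) (k : nat) (x : R) :
  (cheb k).1.[cos x] = cos (k%:R * x) /\ (cheb k).2.[cos x] * sin x = sin (k%:R * x).
Proof.
elim: k => [|k [IH1 IH2]]; first by rewrite /= hornerC horner0 mul0r cos0 sin0 mul0r.
have kx : k.+1%:R * x = k%:R * x + x by rewrite -natr1; ring.
rewrite kx cosD sinD /= !hornerE IH1 -IH2; split; last by ring.
have h := sin2cos2 x; rewrite -mulrA -expr2 h; ring.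
Qed.

Lemma cheb1_le1 (R : realType) (k : nat) (c : R) : -1 <= c <= 1 -> `|(cheb k).1.[c]| <= 1.
Proof.
move=> c1; have <- : cos (acos c) = c by rewrite acosK // in_itv.
by rewrite (cheb_cos R k _).1 ler_norml cos_geN1 cos_le1.
Qed.

Lemma cheb2_le (R : realType) (k : nat) (c : R) : -1 <= c <= 1 -> `|(cheb k).2.[c]| <= k%:R.
Proof.
move=> c1; elim: k => [|k IH]; first by rewrite /= horner0 normr0.
rewrite /= !hornerE; apply: le_trans (ler_normD _ _) _.
rewrite -natr1 lerD ?cheb1_le1 // normrM -[leRHS]mul1r ler_pM //.
by rewrite ler_norml.
Qed.

Lemma cheb2_rec (R : realType) (k : nat) :
  (cheb k.+2).2 = 2 * 'X * (cheb k.+1).2 - (cheb k).2 :> {poly R}.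
Proof. by rewrite /=; ring. Qed.

Definition shiftp {R : realType} (c : R) (p : {poly R}) : {poly R} := p \Po ('X + c%:P).

Lemma horner_shiftp (R : realType) (c y : R) (p : {poly R}) : (shiftp c p).[y] = p.[y + c].
Proof. by rewrite /shiftp horner_comp !hornerE. Qed.

(* Variation of constants for the three term recurrence, perturbed from c to c + 'X. *)
Lemma shift_cheb2 (R : realType) (c : R) (k : nat) :
  shiftp c (cheb k).2 = ((cheb k).2.[c])%:P
    + 2 * 'X * \sum_(j < k) ((cheb (k - j)%N).2.[c])%:P * shiftp c (cheb j).2.
Proof.
set V := fun k => shiftp c (cheb k).2; set v := fun k => (cheb k).2.[c].
change (V k = (v k)%:P + 2 * 'X * \sum_(j < k) (v (k - j)%N)%:P * V j).
have V0 : V 0%N = 0 by rewrite /V /shiftp /= comp_poly0.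
have V1 : V 1%N = 1 by rewrite /V /shiftp /= mulr0 add0r -polyC1 comp_polyC.
have v0 : v 0%N = 0 by rewrite /v /= horner0.
have v1 : v 1%N = 1 by rewrite /v /= mulr0 add0r hornerC.
have VE n : V n.+2 = 2 * ('X + c%:P) * V n.+1 - V n.
  rewrite /V /shiftp cheb2_rec rmorphB !rmorphM /= comp_polyX.
  by rewrite rmorph_nat.
have vE n : v n.+2 = 2 * c * v n.+1 - v n by rewrite /v cheb2_rec !hornerE.
(* The recurrence has three terms, so the induction carries two consecutive indices. *)
suff: V k = (v k)%:P + 2 * 'X * \sum_(j < k) (v (k - j)%N)%:P * V j /\
  V k.+1 = (v k.+1)%:P + 2 * 'X * \sum_(j < k.+1) (v (k.+1 - j)%N)%:P * V j by case.
elim: k => [|k [IH0 IH1]].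
  by rewrite big_ord0 big_ord_recl big_ord0 V0 V1 v0 v1; split; rewrite !(mulr0, addr0).
split => //; rewrite VE.
(* The convolution inherits the recurrence of [v]; the term [j = k] fits because [v 0 = 0], and
   [j = k + 1] gives the source term. *)
have -> : \sum_(j < k.+2) (v (k.+2 - j)%N)%:P * V j = V k.+1
  + (2 * c)%:P * (\sum_(j < k.+1) (v (k.+1 - j)%N)%:P * V j)
  - \sum_(j < k) (v (k - j)%N)%:P * V j.
  have -> : \sum_(j < k) (v (k - j)%N)%:P * V j = \sum_(j < k.+1) (v (k - j)%N)%:P * V j.
    by rewrite big_ord_recr /= subnn v0 mul0r addr0.
  rewrite big_ord_recr /= subSnn v1 mul1r addrC -addrA; congr (_ + _).
  rewrite mulr_sumr -sumrB; apply: eq_bigr => j _.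
  have jk : (j <= k)%N by rewrite -ltnS.
  by rewrite !subSn ?vE ?(leqW jk) // !(polyCB, polyCM); ring.
rewrite vE polyCB !polyCM [in LHS]IH0 [2 * ('X + _)]mulrDr mulrDl.
rewrite [X in 2 * c%:P * X]IH1; ring.
Qed.

Lemma sum_linear_geometric (R : realType) (s : R) (k : nat) :
  s ^+ 2 * \sum_(j < k) (k - j)%:R * (1 + s) ^+ j = (1 + s) ^+ k.+1 - (1 + s) - k%:R * s.
Proof.
elim: k => [|k IH]; first by rewrite big_ord0; ring.
have -> : \sum_(j < k.+1) (k.+1 - j)%:R * (1 + s) ^+ j
  = \sum_(j < k) (k - j)%:R * (1 + s) ^+ j + \sum_(j < k.+1) (1 + s) ^+ j.
  rewrite [in RHS]big_ord_recr /= addrA -big_split big_ord_recr /= subSnn mul1r; congr (_ + _).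
  apply: eq_bigr => j _; rewrite subSn; last by rewrite ltnW.
  by rewrite -natr1 mulrDl mul1r.
have g := subrX1 (1 + s) k.+1.
have {}g : s * \sum_(j < k.+1) (1 + s) ^+ j = (1 + s) ^+ k.+1 - 1 by rewrite g; ring.
by rewrite mulrDr IH expr2 -[s * s * _]mulrA g -natr1 [(1 + s) ^+ k.+2]exprS; ring.
Qed.

(** The radius [r] is the one for which [q = 1 + s] solves [q + 1/q = 2 (1 + r)], so the majorant
    recurrence obtained from [shift_cheb2] grows like [q ^+ k]. *)
Lemma cnorm_shift_cheb2 (R : realType) (s c : R) (k : nat) : 0 < s -> -1 <= c <= 1 ->
  cnorm (s ^+ 2 / (2 * (1 + s))) (shiftp c (cheb k).2) <= (1 + s) / s * (1 + s) ^+ k.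
Proof.
move=> s0 c1; set q := 1 + s; set r := s ^+ 2 / _.
have q0 : 0 < q by rewrite /q; lra.
have r0 : 0 <= r by rewrite /r divr_ge0 ?sqr_ge0 // mulr_ge0 ?ltW.
have D0 : 0 <= q / s by rewrite divr_ge0 ?ltW.
elim/ltn_ind: k => k IH; rewrite shift_cheb2.
apply: le_trans (cnormD _ _ _ _ r0) _; rewrite cnormC.
have -> : forall S : {poly R}, 2 * 'X * S = 2 *: (S * 'X).
  by move=> S; rewrite -mul_polyC polyC_natr; ring.
rewrite cnormZ cnormMX normr_nat.
have B1 : cnorm r (\sum_(j < k) ((cheb (k - j)).2.[c])%:P * shiftp c (cheb j).2)
    <= q / s * \sum_(j < k) (k - j)%:R * q ^+ j.
  apply: le_trans (cnorm_sum R r k (fun j => ((cheb (k - j)).2.[c])%:P * shiftp c (cheb j).2) r0) _.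
  rewrite mulr_sumr; apply: ler_sum => j _; rewrite mul_polyC cnormZ.
  rewrite mulrCA ler_pM ?cnorm_ge0 ?cheb2_le //.
  exact: IH.
have r2 : 0 <= 2 * r by rewrite mulr_ge0.
have {B1} := ler_wpM2l r2 B1.
have g := sum_linear_geometric R s k; rewrite -/q in g.
have -> : 2 * r * (q / s * \sum_(j < k) (k - j)%:R * q ^+ j) = (q ^+ k.+1 - q - k%:R * s) / s.
  have qn : 1 + s != 0 by rewrite gt_eqF.
  have sn : s != 0 by rewrite gt_eqF.
  by rewrite -g /r; field; rewrite sn qn.
have vk := cheb2_le R k c c1.
(* The leftover [- k] absorbs the constant term, which is at most [k] in absolute value. *)
have -> : (q ^+ k.+1 - q - k%:R * s) / s = q / s * q ^+ k - q / s - k%:R.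
  by rewrite exprS; field; rewrite gt_eqF.
move=> h; rewrite [2 * (r * _)]mulrA; move: h vk D0; lra.
Qed.

(** Reduction to the second kind by [T_k = U_k - x U_(k-1)]; the constant 8 is [(1 + s) (3 + s)] at
    [s = 1]. *)
Lemma cnorm_shift_cheb1 (R : realType) (s c : R) (k : nat) : 0 < s <= 1 -> -1 <= c <= 1 ->
  cnorm (s ^+ 2 / (2 * (1 + s))) (shiftp c (cheb k).1) <= 8 / s * (1 + s) ^+ k.
Proof.
move=> /andP[s0 s1] c1; set r := s ^+ 2 / _.
have r0 : 0 <= r by rewrite /r divr_ge0 ?sqr_ge0 //; lra.
have r1 : r <= 1 by rewrite /r ler_pdivrMr; nra.
have -> : shiftp c (cheb k).1
    = shiftp c (cheb k.+1).2 + (-1) *: (shiftp c (cheb k).2 * 'X + c *: shiftp c (cheb k).2).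
  have -> : (cheb k).1 = (cheb k.+1).2 - 'X * (cheb k).2 :> {poly R} by rewrite /=; ring.
  by rewrite /shiftp rmorphB rmorphM /= comp_polyX scaleN1r -mul_polyC; ring.
apply: le_trans (cnormD _ _ _ _ r0) _; rewrite cnormZ normrN1 mul1r.
have B1 := cnorm_shift_cheb2 R s c k.+1 s0 c1.
have B2 := cnorm_shift_cheb2 R s c k s0 c1.
have B3 := cnormD R r (shiftp c (cheb k).2 * 'X) (c *: shiftp c (cheb k).2) r0.
rewrite cnormMX cnormZ in B3; rewrite -/r in B1 B2.
have N0 := cnorm_ge0 R r (shiftp c (cheb k).2) r0.
have cn : `|c| <= 1 by rewrite ler_norml.
have B4 : r * cnorm r (shiftp c (cheb k).2) <= cnorm r (shiftp c (cheb k).2).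
  by rewrite -[leRHS]mul1r ler_wpM2r.
have B5 : `|c| * cnorm r (shiftp c (cheb k).2) <= cnorm r (shiftp c (cheb k).2).
  by rewrite -[leRHS]mul1r ler_wpM2r.
have E : (1 + s) / s * (1 + s) ^+ k.+1 + 2 * ((1 + s) / s * (1 + s) ^+ k)
    = (1 + s) * (3 + s) * ((1 + s) ^+ k / s) by rewrite exprS; field; rewrite gt_eqF.
have X0 : 0 <= (1 + s) ^+ k / s by rewrite divr_ge0 ?exprn_ge0 // ltW //; lra.
have B6 : (1 + s) * (3 + s) * ((1 + s) ^+ k / s) <= 8 * ((1 + s) ^+ k / s).
  by apply: ler_wpM2r => //; nra.
have -> : 8 / s * (1 + s) ^+ k = 8 * ((1 + s) ^+ k / s) by ring.
lra.
Qed.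

(** Degrees and signs go together because the leading coefficient of [T_(k+1)] is the sum of those
    of [T_k] and [U_(k-1)]. The last sign is not strict since the second component vanishes at
    [k = 0]. *)
Lemma cheb_size (R : realType) (k : nat) :
  [/\ (size ((cheb k).1 : {poly R}) <= k.+1)%N, (size ((cheb k).2 : {poly R}) <= k)%N,
    0 < ((cheb k).1 : {poly R})`_k & 0 <= ((cheb k).2 : {poly R})`_k.-1].
Proof.
elim: k => [|k [s1 s2 c1 c2]].
  by split; rewrite /= ?size_poly1 ?size_poly0 ?coef1 ?coef0 ?ltr01.
have h2 : (size ('X ^+ 2 * (cheb k).2 : {poly R})%R <= k.+2)%N.
  apply: leq_trans (size_polyMleq _ _) _; rewrite size_polyXn; lia.
have h1 : forall p : {poly R}, (size p <= k.+1)%N -> (size ('X * p)%R <= k.+2)%N.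
  by move=> p sp; apply: leq_trans (size_polyMleq _ _) _; rewrite size_polyX; lia.
have h1' : (size ('X * (cheb k).2 : {poly R})%R <= k.+1)%N.
  by apply: leq_trans (size_polyMleq _ _) _; rewrite size_polyX; lia.
have e : (1 - 'X ^+ 2) * (cheb k).2 = (cheb k).2 - 'X ^+ 2 * (cheb k).2 :> {poly R} by ring.
split => /=.
- rewrite e; apply: leq_trans (size_polyD _ _) _; rewrite geq_max h1 //= size_polyN.
  apply: leq_trans (size_polyD _ _) _; rewrite geq_max size_polyN h2 andbT.
  by apply: leq_trans s2 _; lia.
- by apply: leq_trans (size_polyD _ _) _; rewrite geq_max h1' s1.
- rewrite e !coefB coefXM coefXnM /= (nth_default _ (leqW s2)) sub0r opprK.
  apply: ltr_wpDr => //; case: k c2 {s1 s2 c1 h1 h2 h1' e} => [|k] //= c2.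
  by rewrite subSS subn1.
- rewrite coefD coefXM; case: k c1 c2 {s1 s2 h1 h2 h1' e} => [|k] /= c1 c2.
    by rewrite add0r ltW.
  by rewrite addr_ge0 // ltW.
Qed.

(** * Chebyshev coefficients through discrete orthogonality of cosines *)

Lemma cheb_expansion (R : realType) (n : nat) (p : {poly R}) : (size p <= n)%N ->
  exists a : nat -> R, p = \sum_(k < n) a k *: (cheb k).1.
Proof.
elim: n p => [|n IH] p sp.
  by exists (fun=> 0); rewrite big_ord0; apply/eqP; rewrite -size_poly_leq0.
have [s1 _ c1 _] := cheb_size R n.
set b := p`_n / (cheb n).1`_n.
have [|a pE] := IH (p - b *: (cheb n).1).
  apply/leq_sizeP => j nj; rewrite coefB coefZ.
  move: nj; rewrite leq_eqVlt => /orP[/eqP <-|nj].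
    by rewrite /b divfK ?subrr // gt_eqF.
  by rewrite !nth_default ?mulr0 ?subr0 // (leq_trans _ nj).
exists (fun k => if k == n then b else a k).
rewrite big_ord_recr /= eqxx -[LHS](subrK (b *: (cheb n).1)) pE; congr (_ + _).
by apply: eq_bigr => i _; rewrite ltn_eqF.
Qed.

Lemma sum_cos_eq0 (R : realType) (N r : nat) : (0 < r < N)%N ->
  \sum_(j < N) cos (r%:R * (j%:R * (2 * pi / N%:R))) = 0 :> R.
Proof.
move=> /andP[r0 rN]; have N0 : 0 < N%:R :> R by rewrite ltr0n (leq_trans _ rN).
set b : R := r%:R * (pi / N%:R).
have pi0 := pi_gt0 R.
have b0 : 0 < b by rewrite mulr_gt0 ?ltr0n // divr_gt0.
have bpi : b < pi.
  by rewrite /b mulrCA gtr_pMr // ltr_pdivrMr // mul1r ltr_nat.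
have sb : sin b != 0 by rewrite gt_eqF // sin_gt0_pi // b0.
apply: (mulfI sb); rewrite mulr0 mulr_sumr.
(* Multiplying by the sine of the half step [b] makes the sum telescope; over a full period the end
   terms cancel. *)
have E : forall m : nat, \sum_(j < m) sin b * cos (r%:R * (j%:R * (2 * pi / N%:R)))
    = (sin ((2 * m%:R - 1) * b) + sin b) / 2.
  elim=> [|m IH].
    have -> : (2 * 0%:R - 1) * b = - b by ring.
    by rewrite big_ord0 sinN addNr mul0r.
  rewrite big_ord_recr /= IH.
  have -> : r%:R * (m%:R * (2 * pi / N%:R)) = (2 * m%:R) * b by rewrite /b; ring.
  have -> : (2 * m.+1%:R - 1) * b = 2 * m%:R * b + b by rewrite -natr1; ring.
  have -> : (2 * m%:R - 1) * b = 2 * m%:R * b - b by ring.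
  by rewrite sinB sinD; field.
rewrite E.
have -> : (2 * N%:R - 1) * b = - b + (pi *+ 2) *+ r.
  by rewrite /b -(mulr_natr _ r) -(mulr_natr pi 2); field; rewrite gt_eqF.
suff -> : sin (- b + (pi *+ 2) *+ r) = - sin b by rewrite addNr mul0r.
rewrite -sinN; move: (- b) => x; elim: (r) x => [|m IH] x; first by rewrite mulr0n addr0.
by rewrite mulrS addrA IH sinD2pi.
Qed.

(** With [2 n + 1] nodes both frequencies [k - l] and [k + l] lie strictly between 0 and the number
    of nodes. *)
Lemma sum_cos_cos (R : realType) (n k l : nat) : (k <= n)%N -> (l < k)%N ->
  \sum_(j < n.*2.+1) cos (k%:R * (j%:R * (2 * pi / n.*2.+1%:R)))
     * cos (l%:R * (j%:R * (2 * pi / n.*2.+1%:R))) = 0 :> R.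
Proof.
move=> kn lk.
have h1 := @sum_cos_eq0 R n.*2.+1 (k - l) ltac:(lia).
have h2 := @sum_cos_eq0 R n.*2.+1 (k + l) ltac:(lia).
have two : (2 : R) != 0 by [].
apply: (mulfI two); rewrite mulr0 -[RHS](addr0 0) -[X in X + _]h1 -[X in _ + X]h2.
rewrite mulr_sumr -big_split /=; apply: eq_bigr => j _.
rewrite natrB ?(ltnW lk) // natrD; set y := j%:R * _.
by rewrite [(k%:R - _) * y]mulrBl [(k%:R + _) * y]mulrDl cosB cosD; ring.
Qed.

Lemma sum_cos_sqr_ge (R : realType) (n k : nat) : (k <= n)%N ->
  n.*2.+1%:R / 2 <= \sum_(j < n.*2.+1) cos (k%:R * (j%:R * (2 * pi / n.*2.+1%:R)))
     * cos (k%:R * (j%:R * (2 * pi / n.*2.+1%:R))) :> R.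
Proof.
move=> kn; set N := n.*2.+1.
have : 0 <= \sum_(j < N) cos ((k + k)%:R * (j%:R * (2 * pi / N%:R))) :> R.
  case: k kn => [|k] kn; last by rewrite sum_cos_eq0 //; lia.
  by apply: sumr_ge0 => j _; rewrite mul0r cos0.
have -> : \sum_(j < N) cos ((k + k)%:R * (j%:R * (2 * pi / N%:R)))
  = 2 * (\sum_(j < N) cos (k%:R * (j%:R * (2 * pi / N%:R))) * cos (k%:R * (j%:R * (2 * pi / N%:R))))
    - N%:R :> R.
  rewrite mulr_sumr -[N in X in _ - X%:R]card_ord -sumr_const -sumrB; apply: eq_bigr => j _.
  set y := j%:R * _; rewrite natrD [(_ + _) * y]mulrDl cosD; set x := k%:R * _.
  have := cos2Dsin2 x; rewrite !expr2 => h; rewrite -[X in _ = _ - X]h; ring.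
lra.
Qed.

(** Testing [p] against [cos (k x)] at the nodes isolates [a k] times a sum of squares, which is at
    least half the number of nodes. *)
Lemma cheb_coef_le (R : realType) (A : R) (n : nat) (a : nat -> R) (p : {poly R}) :
  p = \sum_(k < n.+1) a k *: (cheb k).1 ->
  (forall x, -1 <= x <= 1 -> `|p.[x]| <= A) ->
  forall k, (k <= n)%N -> `|a k| <= 2 * A.
Proof.
move=> pE pA k kn; set N := n.*2.+1; pose x (j : nat) : R := j%:R * (2 * pi / N%:R).
have N0 : 0 < N%:R :> R by rewrite ltr0n.
have H : \sum_(j < N) p.[cos (x j)] * cos (k%:R * x j)
    = a k * \sum_(j < N) cos (k%:R * x j) * cos (k%:R * x j).
  transitivity (\sum_(j < N) \sum_(l < n.+1) a l * (cos (l%:R * x j) * cos (k%:R * x j))).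
    apply: eq_bigr => j _; rewrite pE horner_sum mulr_suml; apply: eq_bigr => l _.
    by rewrite hornerZ (cheb_cos R l _).1 mulrA.
  rewrite exchange_big /= (bigD1 (Ordinal (kn : (k < n.+1)%N))) //= -mulr_sumr.
  rewrite [X in _ + X]big1 ?addr0 // => l lk; rewrite -mulr_sumr.
  suff -> : \sum_(j < N) cos (l%:R * x j) * cos (k%:R * x j) = 0 by rewrite mulr0.
  have ln : (l <= n)%N by rewrite -ltnS.
  case: (ltngtP l k) => [lk'|kl|e].
  - under eq_bigr do rewrite mulrC; exact: sum_cos_cos.
  - exact: sum_cos_cos.
  - by case/eqP: lk; apply/val_inj.
set C := \sum_(j < N) cos (k%:R * x j) * _ in H.
have C0 := sum_cos_sqr_ge R n k kn; rewrite -/N -/C in C0.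
have U : `|a k * C| <= N%:R * A.
  rewrite -H; apply: le_trans (ler_norm_sum _ _ _) _.
  rewrite -[N in leRHS]card_ord mulr_natl -sumr_const; apply: ler_sum => j _.
  rewrite normrM -[leRHS]mulr1 ler_pM // ?pA ?cos_geN1 ?cos_le1 //.
  by rewrite ler_norml cos_geN1 cos_le1.
have Cp : 0 < C by apply: lt_le_trans C0; rewrite divr_gt0.
rewrite normrM (gtr0_norm Cp) in U.
have h := ler_wpM2l (normr_ge0 (a k)) C0.
have h2 := le_trans h U.
rewrite -(ler_pM2r N0); move: h2; lra.
Qed.

(** A real-variable substitute for the Bernstein-Walsh and Cauchy estimates, uniform in [c] up to
    the endpoints, with growth rate [1 + s] on a radius of order [s ^+ 2]. *)
Lemma cnorm_shift_le (R : realType) (s c A : R) (n : nat) (p : {poly R}) :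
  0 < s <= 1 -> -1 <= c <= 1 -> (size p <= n.+1)%N ->
  (forall x, -1 <= x <= 1 -> `|p.[x]| <= A) ->
  cnorm (s ^+ 2 / (2 * (1 + s))) (shiftp c p) <= n.+1%:R * (16 * A / s) * (1 + s) ^+ n.
Proof.
move=> s01 c1 sp pA; have /andP[s0 s1] := s01; set r := s ^+ 2 / _.
have r0 : 0 <= r by rewrite /r divr_ge0 ?sqr_ge0 //; lra.
have [a pE] := cheb_expansion R n.+1 p sp.
have aA := @cheb_coef_le R A n a p pE pA.
have -> : shiftp c p = \sum_(k < n.+1) a k *: shiftp c (cheb k).1.
  by rewrite pE /shiftp rmorph_sum /=; apply: eq_bigr => i _; rewrite comp_polyZ.
apply: le_trans (cnorm_sum R r n.+1 (fun k => a k *: shiftp c (cheb k).1) r0) _.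
rewrite -mulrA -[n.+1 in leRHS]card_ord mulr_natl -sumr_const; apply: ler_sum => k _.
rewrite cnormZ.
have -> : 16 * A / s * (1 + s) ^+ n = (2 * A) * (8 / s * (1 + s) ^+ n) by ring.
have kn : (k <= n)%N by rewrite -ltnS.
apply: ler_pM; rewrite ?cnorm_ge0 ?aA //.
apply: le_trans (cnorm_shift_cheb1 _ _ _ _ s01 c1) _.
by rewrite ler_wpM2l ?divr_ge0 ?(ltW s0) // ler_weXn2l //; lra.
Qed.

(** * Interpolation at points of a set of positive measure *)

(** Greedy choice: take a point within [tau] of the infimum and discard everything below that point
    plus [tau], which loses measure at most [2 tau]. *)
Lemma spaced_points (R : realType) (tau : R) (m : nat) (E : set R) : 0 < tau ->
  measurable E -> has_lbound E -> ((m%:R * (2 * tau))%:E <= lebesgue_measure E)%E ->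
  exists x : nat -> R, (forall i, (i < m)%N -> E (x i)) /\
    (forall i j, (i < j < m)%N -> (j - i)%:R * tau <= x j - x i).
Proof.
move=> tau0; elim: m E => [|m IH] E mE lE muE.
  by exists (fun=> 0); split => // i j; rewrite ltn0 andbF.
have E0 : E !=set0.
  apply/set0P/eqP => E0; move: muE; rewrite E0 measure0 lee_fin.
  by rewrite leNgt mulr_gt0 // mulr_gt0.
have [x0 Ex0 x0lt] := inf_adherent tau0 (conj E0 lE).
pose E' := E `&` `[x0 + tau, +oo[.
have mE' : measurable E' by apply: measurableI.
have sub : E `<=` E' `|` `[inf E, x0 + tau].
  move=> y Ey; have [le|lt] := leP (x0 + tau) y.
    by left; split => //=; rewrite in_itv /= le.
  by right; rewrite /= in_itv /= (ltW lt) andbT; exact: ge_inf.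
have muE' : ((m%:R * (2 * tau))%:E <= lebesgue_measure E')%E.
  have h : (lebesgue_measure E <= lebesgue_measure E' + (2 * tau)%:E)%E.
    apply: (@le_trans _ _ (lebesgue_measure (E' `|` `[inf E, x0 + tau]))).
      by apply: le_measure; rewrite ?inE //; exact: measurableU.
    apply: le_trans (measureU2 _ _ _) _ => //.
    rewrite leeD2l //= lebesgue_measure_itv /= lte_fin; case: ifP => _.
      by rewrite -EFinB lee_fin; lra.
    by rewrite lee_fin; lra.
  have {h} := le_trans muE h.
  by rewrite -natr1 mulrDl mul1r EFinD leeD2rE.
have lE' : has_lbound E'.
  by exists (x0 + tau) => y [_]; rewrite /= in_itv /= andbT.
have [x' [Ex' dx']] := IH E' mE' lE' muE'.
exists (fun i => if i is i'.+1 then x' i' else x0); split.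
  by case=> [|i] // im; have [] := Ex' i im.
move=> [|i] [|j] // /andP[ij jm].
- have j0 : x0 + tau <= x' 0%N.
    have [|_ /=] := Ex' 0%N; first by rewrite (leq_ltn_trans _ (jm : (j < m)%N)).
    by rewrite in_itv /= andbT.
  case: j jm {ij} => [|j] jm; first by rewrite subn0 mul1r; lra.
  have := dx' 0%N j.+1 jm; rewrite !subn0 -(natr1 j.+1) mulrDl mul1r; lra.
- by rewrite subSS; apply: dx'; rewrite -ltnS ij.
Qed.

(** Subtraction is truncated, so each factor is the distance between [i] and [k]: this is the
    Lagrange denominator for the nodes 0, ..., [M]. *)
Lemma prod_dist_fact (M i : nat) : (i <= M)%N ->
  (\prod_(k < M.+1 | k != i :> nat) ((i - k) + (k - i)))%N = (i`! * (M - i)`!)%N.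
Proof.
move=> iM; rewrite -(subnKC iM); move: (M - i)%N => d; rewrite addKn.
elim: d => [|d IH].
  rewrite addn0 fact0 muln1 big_mkcond big_ord_recr /= eqxx muln1.
  elim: i {M iM} => [|i IH]; first by rewrite big_ord0.
  rewrite big_ord_recl /= subn0 addn0 factS -IH; congr muln.
rewrite addnS big_mkcond big_ord_recr /= -big_mkcond /= IH.
have -> : ((i + d).+1 != i) by lia.
rewrite factS; have -> : (i - (i + d).+1 + ((i + d).+1 - i) = d.+1)%N by lia.
by rewrite mulnA mulnAC mulnC mulnA.
Qed.

Lemma bin_leq_expn2 (n k : nat) : ('C(n, k) <= 2 ^ n)%N.
Proof.
elim: n k => [|n IH] [|k] //; first by rewrite bin0 expn_gt0.
by rewrite binS expnS mul2n -addnn leq_add.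
Qed.

Lemma expn_le_fact (R : realType) (M : nat) :
  M.+1%:R ^+ M <= expR 1 ^+ M * M`!%:R :> R.
Proof.
elim: M => [|M IH]; first by rewrite !expr0 mul1r.
have M0 : 0 < M.+1%:R :> R by rewrite ltr0n.
have -> : M.+2%:R = M.+1%:R * (1 + M.+1%:R^-1) :> R.
  by rewrite -(natr1 M.+1); field; rewrite gt_eqF.
rewrite exprMn [_ ^+ M.+1]exprSr factS natrM.
have h : (1 + M.+1%:R^-1) ^+ M.+1 <= expR 1 :> R.
  have -> : expR 1 = expR (M.+1%:R^-1) ^+ M.+1 :> R.
    by rewrite -expRM_natl mulfV // gt_eqF.
  rewrite lerXn2r ?nnegrE ?expR_ge0 ?expR_ge1Dx // addr_ge0 // invr_ge0 ltW //.
have -> : expR 1 ^+ M.+1 * (M.+1%:R * M`!%:R) = (expR 1 ^+ M * M`!%:R * M.+1%:R) * expR 1 :> R.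
  by rewrite exprS; ring.
rewrite ler_pM ?h ?mulr_ge0 ?exprn_ge0 ?addr_ge0 ?invr_ge0 ?(ltW M0) //.
by rewrite ler_wpM2r // ltW.
Qed.

Lemma expn_le_fact_fact (R : realType) (M i : nat) : (i <= M)%N ->
  M.+1%:R ^+ M <= (2 * expR 1) ^+ M * (i`! * (M - i)`!)%:R :> R.
Proof.
move=> iM; apply: le_trans (expn_le_fact R M) _.
rewrite exprMn [2 ^+ M * _]mulrC -mulrA ler_wpM2l ?exprn_ge0 ?expR_ge0 //.
by rewrite -(bin_fact iM) -natrX -natrM ler_nat leq_mul // bin_leq_expn2.
Qed.

(** In Lagrange's formula the spacing compares each denominator with that of equidistant nodes, a
    product of factorials bounded below by [expn_le_fact_fact]. *)
Lemma lagrange_le (R : realType) (L : {poly R}) (x : nat -> R) (M : nat) (a tau h y : R) :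
  (size L <= M.+1)%N -> 0 < tau -> 0 <= h ->
  (forall i, (i <= M)%N -> `|L.[x i]| <= a) ->
  (forall i j, (i < j <= M)%N -> (j - i)%:R * tau <= x j - x i) ->
  (forall i, (i <= M)%N -> `|y - x i| <= h) ->
  `|L.[y]| <= M.+1%:R * a * (2 * expR 1 * h / (tau * M.+1%:R)) ^+ M.
Proof.
move=> sL tau0 h0 La dx yx.
have dx2 i j : (i <= M)%N -> (j <= M)%N -> ((i - j) + (j - i))%:R * tau <= `|x i - x j|.
  move=> iM jM; case: (ltngtP i j) => [ij|ij|->]; last by rewrite subnn mul0r.
  - rewrite distrC; apply: le_trans _ (ler_norm _).
    have -> : (i - j + (j - i) = j - i)%N by lia.
    by apply: dx; rewrite ij.
  - apply: le_trans _ (ler_norm _).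
    have -> : (i - j + (j - i) = i - j)%N by lia.
    by apply: dx; rewrite ij.
have neq i j : (i <= M)%N -> (j <= M)%N -> i != j -> x i - x j != 0.
  move=> iM jM ij; rewrite -normr_gt0; apply: lt_le_trans (dx2 i j iM jM).
  by rewrite mulr_gt0 // ltr0n; lia.
pose W (i : 'I_M.+1) : {poly R} := \prod_(k < M.+1 | k != i) ('X - (x k)%:P).
pose w (i : 'I_M.+1) : R := \prod_(k < M.+1 | k != i) (x i - x k).
have WE i z : (W i).[z] = \prod_(k < M.+1 | k != i) (z - x k).
  by rewrite horner_prod; apply: eq_bigr => k _; rewrite hornerXsubC.
have w0 i : w i != 0.
  apply/prodf_neq0 => k ki; apply: neq; rewrite -1?ltnS //.
  by apply: contra ki => /eqP e; apply/eqP/val_inj.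
have card i : #|[pred k : 'I_M.+1 | k != i]| = M.
  by have := cardC1 i; rewrite card_ord /= => ci; rewrite -[RHS]ci; apply: eq_card => k; rewrite !inE.
have LE : L = \sum_(i < M.+1) (L.[x i] / w i) *: W i.
  (* [D] vanishes at [M + 1] distinct nodes and has degree at most [M]. *)
  apply/eqP; rewrite -subr_eq0; apply/eqP; set D := L - _.
  apply: (@roots_geq_poly_eq0 _ D [seq x (i : 'I_M.+1) | i <- enum 'I_M.+1]).
  - apply/allP => z /mapP[i _ ->]; apply/rootP.
    rewrite /D hornerD hornerN horner_sum (bigD1 i) //= big1 => [|k ki].
      by rewrite hornerZ WE -/(w i) divfK // addr0 subrr.
    by rewrite hornerZ WE (bigD1 i) 1?eq_sym //= subrr mul0r mulr0.
  - rewrite map_inj_uniq ?enum_uniq // => i j eij; apply/val_inj/eqP.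
    apply: contraT => ij; have := neq i j (ltn_ord i) (ltn_ord j) ij.
    by rewrite eij subrr eqxx.
  - rewrite size_map size_enum_ord; apply: leq_trans (size_polyD _ _) _.
    rewrite geq_max sL size_polyN; apply: leq_trans (size_sum _ _ _) _.
    apply/bigmax_leqP => i _; apply: leq_trans (size_scale_leq _ _) _.
    rewrite /W -big_filter (size_prod_XsubC _ (fun k : 'I_M.+1 => x k)) ltnS.
    by rewrite -sum1_size big_filter sum1_card card.
rewrite LE horner_sum; apply: le_trans (ler_norm_sum _ _ _) _.
rewrite -mulrA -[M.+1 in leRHS]card_ord mulr_natl -sumr_const; apply: ler_sum => i _.
have iM : (i <= M)%N by rewrite -ltnS.
rewrite card_ord hornerZ normrM normrM -mulrA ler_pM // ?La // WE.
have num : `|\prod_(k < M.+1 | k != i) (y - x k)| <= h ^+ M.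
  rewrite normr_prod -[in leRHS](card i) -prodr_const; apply: ler_prod => k _.
  by rewrite normr_ge0 yx // -ltnS.
have den : (i`! * (M - i)`!)%:R * tau ^+ M <= `|w i|.
  rewrite /w normr_prod -prod_dist_fact // -[X in _ ^+ X](card i) -prodr_const natr_prod -big_split /=.
  rewrite big_mkcond [leRHS]big_mkcond; apply: ler_prod => k _ /=.
  have -> : (k != i :> nat) = (k != i) by [].
  case: ifP => _; last by rewrite ler01 lexx.
  by rewrite mulr_ge0 ?(ltW tau0) //= dx2 // -ltnS.
have F0 : 0 < (i`! * (M - i)`!)%:R :> R by rewrite ltr0n muln_gt0 !fact_gt0.
have M0 : 0 < M.+1%:R :> R by rewrite ltr0n.
rewrite normfV mulrC ler_pdivrMr ?normr_gt0 //.
apply: le_trans num _.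
have e0 := expR_gt0 (1 : R).
set Q := 2 * expR 1 * h / _.
have Q0 : 0 <= Q by rewrite /Q divr_ge0 ?mulr_ge0 // ltW.
apply: le_trans _ (ler_wpM2l (exprn_ge0 M Q0) den).
have -> : Q ^+ M * ((i`! * (M - i)`!)%:R * tau ^+ M)
  = h ^+ M * (((2 * expR 1) ^+ M * (i`! * (M - i)`!)%:R) / M.+1%:R ^+ M).
  have -> : Q = h * (2 * expR 1) / (tau * M.+1%:R) by rewrite /Q; ring.
  by rewrite expr_div_n !exprMn; field; rewrite !expf_neq0 ?gt_eqF.
rewrite -[leLHS]mulr1 ler_wpM2l ?exprn_ge0 // ler_pdivlMr ?exprn_gt0 // mul1r.
exact: expn_le_fact_fact.
Qed.

Lemma interp_bound (R : realType) (p : {poly R}) (c h rho a mu x : R) (E : set R) (M : nat) :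
  measurable E -> E `<=` `[c - h, c + h] -> 0 < mu -> (mu%:E <= lebesgue_measure E)%E ->
  0 < h < rho -> (forall z, E z -> `|p.[z]| <= a) -> c - h <= x <= c + h ->
  `|p.[x]| <= M.+1%:R * a * (8 * expR 1 * h / mu) ^+ M
     + cnorm rho (shiftp c p) * (2 * h / (rho - h)) ^+ M.+1.
Proof.
move=> mE Ech mu0 muE /andP[h0 hr] pa xch.
have M0 : 0 < M.+1%:R :> R by rewrite ltr0n.
(* This spacing uses up exactly the measure [mu] for [M + 1] nodes, and [tau * M.+1 = mu / 2] makes
   the base of the Lagrange bound independent of [M]. *)
pose tau := mu / (2 * M.+1%:R).
have tau0 : 0 < tau by rewrite divr_gt0 // mulr_gt0.
have lE : has_lbound E.
  by exists (c - h) => z /Ech /=; rewrite in_itv /= => /andP[].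
have [|z [Ez dz]] := @spaced_points R tau M.+1 E tau0 mE lE.
  by rewrite /tau (_ : _ * _ = mu) //; field; rewrite gt_eqF.
have zch i : (i < M.+1)%N -> `|z i - c| <= h.
  by move=> iM; have := Ech _ (Ez i iM); rewrite /= in_itv /= ler_distl.
have [L [g [sL pE gb]]] := @cnorm_newton R rho h (shiftp c p) (fun i => z i - c) M.+1 (ltW h0) hr zch.
have rh : 0 < rho - h by rewrite subr_gt0.
have xc : `|x - c| <= h by rewrite ler_distl.
have -> : p.[x] = L.[x - c] + g.[x - c] * \prod_(i < M.+1) (x - z i).
  have -> : p.[x] = (shiftp c p).[x - c] by rewrite horner_shiftp subrK.
  rewrite pE hornerD hornerM horner_prod; congr (_ + _ * _).
  by apply: eq_bigr => i _; rewrite hornerXsubC; ring.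
apply: le_trans (ler_normD _ _) _; apply: lerD; last first.
  have gx : `|g.[x - c]| <= cnorm rho (shiftp c p) / (rho - h) ^+ M.+1.
    rewrite ler_pdivlMr ?exprn_gt0 // mulrC; apply: le_trans gb.
    rewrite ler_wpM2l ?exprn_ge0 ?(ltW rh) //; apply: horner_le_cnorm.
    exact: le_trans xc (ltW hr).
  have pr : `|\prod_(i < M.+1) (x - z i)| <= (2 * h) ^+ M.+1.
    rewrite normr_prod -[in leRHS](card_ord M.+1) -prodr_const; apply: ler_prod => i _.
    rewrite normr_ge0 /= (_ : x - z i = (x - c) - (z i - c)); last by ring.
    by apply: le_trans (ler_normB _ _) _; have := zch i (ltn_ord i); lra.
  rewrite normrM expr_div_n mulrA mulrAC; exact: ler_pM.
have -> : 8 * expR 1 * h / mu = 2 * expR 1 * (2 * h) / (tau * M.+1%:R).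
  by rewrite /tau; field; rewrite !gt_eqF.
apply: (@lagrange_le R L (fun i => z i - c) M a tau (2 * h)) => //.
- by rewrite mulr_ge0 // ltW.
- move=> i iM; have -> : L.[z i - c] = p.[z i]; last by apply/pa/Ez.
  have -> : p.[z i] = (shiftp c p).[z i - c] by rewrite horner_shiftp subrK.
  rewrite pE hornerD hornerM horner_prod (bigD1 (Ordinal (iM : (i < M.+1)%N))) //=.
  by rewrite hornerXsubC subrr mul0r mulr0 addr0.
- by move=> i j ij; have := dz i j ij; rewrite (_ : z j - c - (z i - c) = z j - z i) //; ring.
- move=> i iM; rewrite /=; apply: le_trans (ler_normB _ _) _.
  by have := zch i iM; lra.
Qed.

(** * Propagation of smallness *)

(* The number M + 1 of interpolation nodes, M = floor (3 sigma n / (theta L)), balances the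
   Lagrange part, of size expR (2 L M - kappa n), with the remainder, of size
   expR (sigma n - theta L (M + 1)). *)
Lemma poly_small_on_interval (R : realType) (kappa theta A a c h L x : R) (n : nat)
    (p : {poly R}) (E : set R) (sigma := theta * kappa / 12)
    (rho := sigma ^+ 2 / (2 * (1 + sigma))) :
  0 < kappa <= 1 -> 0 < theta <= 1 -> 0 <= a ->
  (size p <= n.+1)%N -> (forall z, -1 <= z <= 1 -> `|p.[z]| <= A) ->
  -1 <= c <= 1 -> 0 < h -> 3 <= L -> 4 * h / rho <= expR (- (theta * L)) ->
  measurable E -> E `<=` `[c - h, c + h] ->
  ((2 * h * expR (- L))%:E <= lebesgue_measure E)%E ->
  (forall z, E z -> `|p.[z]| <= a * expR (- (kappa * n%:R))) ->
  c - h <= x <= c + h ->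
  `|p.[x]| <= n.+1%:R * (a + 16 * A / sigma) * expR (- (2 * sigma * n%:R)).
Proof.
have sE : sigma = theta * kappa / 12 by []; clearbody sigma.
move=> /andP[k0 k1] /andP[t0 t1] a0 sp pA c1 h0 L3 hrho mE Ech muE pE xch.
have A0 : 0 <= A by apply: le_trans (normr_ge0 _) (pA 0 _); lra.
have s0 : 0 < sigma by rewrite sE !mulr_gt0.
have tk : theta * kappa <= kappa by rewrite -[leRHS]mul1r ler_pM2r.
have s1 : sigma <= kappa / 12 by rewrite sE ler_pM2r.
have s1' : sigma <= 1 by lra.
have r0 : 0 < rho by rewrite /rho divr_gt0 ?exprn_gt0 //; lra.
have L0 : 0 < L by lra.
have tL0 : 0 < theta * L by rewrite mulr_gt0.
have e1 : expR (- (theta * L)) <= 1 by rewrite -expR0 ler_expR; lra.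
have h4 : 4 * h <= rho.
  by have := le_trans hrho e1; rewrite ler_pdivrMr // mul1r.
have hr : h < rho by lra.
set y := 3 * sigma * n%:R / (theta * L).
have y0 : 0 <= y by rewrite /y divr_ge0 ?(ltW tL0) // !mulr_ge0 // ltW.
have /andP[My yM] := truncn_itv y0; set M := Num.truncn y in My yM.
have muh : 0 < 2 * h * expR (- L) by rewrite !mulr_gt0 ?expR_gt0.
have := @interp_bound R p c h rho (a * expR (- (kappa * n%:R))) _ x E M mE Ech muh muE _ pE xch.
rewrite h0 hr => /(_ isT) H; apply: le_trans H _.
have n0 : 0 <= n%:R :> R by [].
have yE : y * (theta * L) = 3 * sigma * n%:R by rewrite /y divfK // gt_eqF.
have Mn : (M <= n)%N.
  rewrite -(ler_nat R); apply: le_trans My _; rewrite /y ler_pdivrMr //.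
  have -> : 3 * sigma * n%:R = n%:R * theta * (kappa / 4) by rewrite sE; field.
  by rewrite [leRHS]mulrA ler_wpM2l ?mulr_ge0 ?(ltW t0) //; lra.
have Mn1 : M.+1%:R <= n.+1%:R :> R by rewrite ler_nat.
rewrite mulrDr mulrDl; apply: lerD.
(* The condition [3 <= L] enters here, to absorb [4 * expR 1] into a second factor [expR L]. *)
- have b1 : 8 * expR 1 * h / (2 * h * expR (- L)) <= expR (2 * L).
    have -> : 8 * expR 1 * h / (2 * h * expR (- L)) = 4 * expR 1 * expR L.
      by rewrite expRN; field; rewrite !gt_eqF ?expR_gt0.
    have e2 : 4 <= expR 2 :> R.
      have -> : 2 = 2%:R * 1 :> R by rewrite mulr1.
      rewrite expRM_natl expr2; have := expR_ge1Dx (1 : R) => e; nra.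
    have -> : expR (2 * L) = expR (L - 3) * expR 2 * expR 1 * expR L.
      by rewrite -!expRD; congr expR; ring.
    rewrite ler_pM2r ?expR_gt0 // ler_pM2r ?expR_gt0 //.
    have : 1 <= expR (L - 3) by rewrite -[leLHS]expR0 ler_expR; lra.
    move: e2; set u := expR 2; set v := expR (L - 3); nra.
  (* The choice [sigma = theta * kappa / 12] lets the Lagrange growth spend half of the decay
     [kappa n]. *)
  have b2 : (8 * expR 1 * h / (2 * h * expR (- L))) ^+ M <= expR (kappa * n%:R / 2).
    apply: le_trans (_ : expR (2 * L) ^+ M <= _).
      by rewrite lerXn2r ?nnegrE ?expR_ge0 // divr_ge0 ?(ltW muh) // !mulr_ge0 ?expR_ge0 // ltW.
    rewrite -expRM_natl ler_expR -(ler_pM2l t0).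
    have -> : theta * (M%:R * (2 * L)) = 2 * (M%:R * (theta * L)) by ring.
    have : M%:R * (theta * L) <= y * (theta * L) by rewrite ler_wpM2r // ltW.
    rewrite yE => b; apply: le_trans (_ : 2 * (3 * sigma * n%:R) <= _); first by rewrite ler_pM2l.
    by rewrite sE le_eqVlt; apply/orP; left; apply/eqP; field.
  apply: le_trans (_ : n.+1%:R * (a * expR (- (kappa * n%:R))) * expR (kappa * n%:R / 2) <= _).
    apply: ler_pM => //; first by rewrite mulr_ge0 ?mulr_ge0 ?expR_ge0.
      by rewrite exprn_ge0 // divr_ge0 ?(ltW muh) // !mulr_ge0 ?expR_ge0 // ltW.
    by rewrite ler_wpM2r // mulr_ge0 ?expR_ge0.
  rewrite -!mulrA ler_wpM2l // ler_wpM2l // -expRD ler_expR.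
  have : sigma * n%:R <= kappa / 12 * n%:R by rewrite ler_wpM2r.
  have : 0 <= kappa * n%:R by rewrite mulr_ge0 // ltW.
  lra.
- have b1 : cnorm rho (shiftp c p) <= n.+1%:R * (16 * A / sigma) * expR (sigma * n%:R).
    apply: le_trans (cnorm_shift_le R sigma c A n p _ c1 sp pA) _; first by rewrite s0.
    rewrite ler_wpM2l ?mulr_ge0 ?invr_ge0 ?(ltW s0) // mulrC expRM_natl.
    by rewrite lerXn2r ?nnegrE ?expR_ge0 ?expR_ge1Dx //; lra.
  have rh : 0 < rho - h by lra.
  have q0 : 0 <= 2 * h / (rho - h) by rewrite divr_ge0 ?mulr_ge0 // ltW.
  have b2 : (2 * h / (rho - h)) ^+ M.+1 <= expR (- (3 * sigma * n%:R)).
    apply: le_trans (_ : expR (- (theta * L)) ^+ M.+1 <= _).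
      rewrite lerXn2r ?nnegrE ?expR_ge0 //; apply: le_trans hrho.
      by rewrite ler_pdivrMr // mulrAC ler_pdivlMr //; nra.
    rewrite -expRM_natl ler_expR mulrN lerN2 -yE ler_wpM2r //; exact: ltW.
  apply: le_trans (ler_pM (cnorm_ge0 _ _ _ (ltW r0)) (exprn_ge0 _ q0) b1 b2) _.
  rewrite -[leLHS]mulrA -expRD ler_wpM2l ?mulr_ge0 ?invr_ge0 ?(ltW s0) // ler_expR; lra.
Qed.

(** * Near-best polynomials and sublevel sets of a continuous function *)

Lemma bounded_on_segment (R : realType) (f : R -> R) :
  {within `[-1, 1], continuous f} ->
  exists2 F : R, 0 <= F & forall x, -1 <= x <= 1 -> `|f x| <= F.
Proof.
move=> hf; have l : -1 <= 1 :> R by lra.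
have [c1 c1i H1] := EVT_max l hf; have [c2 c2i H2] := EVT_min l hf.
exists (`|f c1| + `|f c2|) => [|x xi]; first by rewrite addr_ge0.
have {}xi : x \in `[-1, 1] by rewrite in_itv.
have := H1 x xi; have := H2 x xi; rewrite ler_norml.
have := ler_norm (f c1); have := ler_norm (- f c2); rewrite normrN.
have := normr_ge0 (f c1); have := normr_ge0 (f c2); move=> *; apply/andP; split; lra.
Qed.

Lemma bestapprox_lt (R : realType) (f : R -> R) (n : nat) (e : R) :
  {within `[-1, 1], continuous f} -> bestapprox f n < e ->
  exists2 p : {poly R}, (size p <= n.+1)%N &
    forall x, -1 <= x <= 1 -> `|f x - p.[x]| <= e.
Proof.
move=> hf; have [F F0 fF] := bounded_on_segment R f hf.
move=> /inf_lt; case; first by exists (supnorm11 (fun x => f x - 0.[x])), 0; rewrite //= size_poly0.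
move=> _ [p /= sp <-] pe; exists p => // x x1; apply: le_trans _ (ltW pe).
rewrite /supnorm11; apply: ub_le_sup; last by exists x => //=; rewrite in_itv.
(* The supremum bounds its members only once the set is known to be bounded above. *)
exists (F + cnorm 1 p) => w [z /=]; rewrite in_itv /= => z1 <-.
apply: le_trans (ler_normB _ _) _; rewrite lerD ?fF //.
by apply: horner_le_cnorm; rewrite ler_norml.
Qed.

Lemma measurable_sublevel (R : realType) (f : R -> R) (t a b : R) :
  {within `[-1, 1], continuous f} -> -1 <= a -> b <= 1 ->
  measurable ([set x | `|f x| <= t] `&` `[a, b]).
Proof.
move=> hf a1 b1.
have mf : measurable_fun (`[-1, 1] : set R) f by apply: subspace_continuous_measurable_fun.
have -> : [set x | `|f x| <= t] `&` `[a, b] = ((`[-1, 1] : set R) `&` f @^-1` `[- t, t]) `&` `[a, b].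
  apply/seteqP; split => x /=; rewrite !in_itv /= ler_norml.
    by move=> [ft /andP[ax xb]]; rewrite ft ax xb; split => //; split => //; lra.
  by move=> [[_ ft] ax].
by apply: measurableI => //; exact: mf.
Qed.

(** Transfers [poly_small_on_interval] from a near-best polynomial to [f]. Half of the decay
    [2 sigma n] pays for the prefactor of order [n], so the constants depend only on [f], [kappa]
    and [theta]. *)
Lemma level_propagation (R : realType) (f : R -> R) (kappa theta : R) :
  {within `[-1, 1], continuous f} -> 0 < kappa <= 1 -> 0 < theta <= 1 ->
  exists sigma rho : R, exists N0 : nat, [/\ 0 < sigma, 0 < rho &
    forall n : nat, (N0 <= n)%N -> bestapprox f n <= expR (- (kappa * n%:R)) ->
    forall c h L : R, -1 <= c - h -> c + h <= 1 -> 0 < h -> 3 <= L ->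
      4 * h / rho <= expR (- (theta * L)) ->
      ((2 * h * expR (- L))%:E <= lebesgue_measure
        ([set x | (`|f x| <= expR (- (kappa * n%:R)))%R] `&` `[(c - h)%R, (c + h)%R]))%E ->
      forall x, c - h <= x <= c + h -> `|f x| <= expR (- (sigma * n%:R))].
Proof.
move=> hf k01 t01; have /andP[k0 k1] := k01; have /andP[t0 t1] := t01.
have [F F0 fF] := bounded_on_segment R f hf.
pose sigma := theta * kappa / 12; pose rho := sigma ^+ 2 / (2 * (1 + sigma)).
have s0 : 0 < sigma by rewrite /sigma !mulr_gt0.
have r0 : 0 < rho by rewrite /rho divr_gt0 ?exprn_gt0 //; lra.
(* In the 5, a share of 3 comes from [|p| <= 3 e] on [E] and 2 from [|f - p| <= 2 e]. *)
pose B := 5 + 16 * (F + 2) / sigma.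
have C0 : 0 <= 16 * (F + 2) / sigma by rewrite divr_ge0 ?(ltW s0) //; lra.
exists sigma, rho, (Num.truncn (8 * B / sigma ^+ 2)).+1; split => //.
move=> n N0n fn c h L ch1 ch2 h0 L3 hrho muE x xch.
have nB : 8 * B <= sigma ^+ 2 * n%:R.
  rewrite [leRHS]mulrC -ler_pdivrMr ?exprn_gt0 //; apply: ltW.
  by apply: lt_le_trans (truncnS_gt _) _; rewrite ler_nat.
set e := expR (- (kappa * n%:R)) in fn muE *.
have e0 : 0 < e by rewrite expR_gt0.
have e1 : e <= 1 by rewrite /e -expR0 ler_expR oppr_le0 mulr_ge0 // ltW.
have [|p sp fp] := @bestapprox_lt R f n (2 * e) hf; first by apply: le_lt_trans fn _; lra.
have pA z : -1 <= z <= 1 -> `|p.[z]| <= F + 2.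
  move=> z1; rewrite -[p.[z]](subKr (f z)).
  by apply: le_trans (ler_normB _ _) _; have := fF z z1; have := fp z z1; lra.
pose E := [set x | `|f x| <= e] `&` `[c - h, c + h].
have ch z : c - h <= z <= c + h -> -1 <= z <= 1 by lra.
have := @poly_small_on_interval R kappa theta (F + 2) 3 c h L x n p E k01 t01 _ sp pA _ h0 L3 hrho.
move=> /(_ _ _ (measurable_sublevel R f e _ _ hf ch1 ch2)).
have i3 : 0 <= 3 :> R by [].
have ic : -1 <= c <= 1 by lra.
have iE : E `<=` `[c - h, c + h] by apply: subIsetr.
have ip z : E z -> `|p.[z]| <= 3 * e.
  move=> [/= fz]; rewrite in_itv /= => zch; rewrite -[p.[z]](subKr (f z)).
  by apply: le_trans (ler_normB _ _) _; have := fp z (ch z zch); lra.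
move=> /(_ i3 ic iE muE ip xch) H.
rewrite -[f x](subrK p.[x]); apply: le_trans (ler_normD _ _) _.
apply: le_trans (lerD (fp x (ch x xch)) H) _.
set w := expR (- (2 * sigma * n%:R)).
have ew : e <= w.
  rewrite /e /w ler_expR lerN2 ler_wpM2r // /sigma.
  have : theta * kappa <= kappa by rewrite -[leRHS]mul1r ler_pM2r.
  lra.
have wE : w = expR (- (sigma * n%:R)) * expR (- (sigma * n%:R)).
  by rewrite /w -expRD; congr expR; ring.
have n1 : 1 <= n%:R :> R by rewrite ler1n (leq_trans _ N0n).
apply: le_trans (_ : n.+1%:R * B * w <= _).
  have w0 : 0 <= w by rewrite expR_ge0.
  have : 2 * w <= n.+1%:R * 2 * w.
    by rewrite ler_wpM2r // -[leLHS]mul1r ler_wpM2r // ler1n.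
  by rewrite /B -/sigma; lra.
rewrite wE mulrA -[leRHS]mul1r ler_wpM2r ?expR_ge0 // expRN ler_pdivrMr ?expR_gt0 // mul1r.
(* The square turns [u <= expR u] into a quadratic lower bound, enough to beat [n.+1 * B] for [n]
   beyond the chosen threshold. *)
have -> : expR (sigma * n%:R) = expR (sigma * n%:R / 2) ^+ 2.
  by rewrite -expRM_natl; congr expR; field.
set u := sigma * n%:R / 2.
have u0 : 0 <= u by rewrite divr_ge0 // mulr_ge0 // ltW.
have h1 : u ^+ 2 <= expR u ^+ 2.
  rewrite lerXn2r ?nnegrE ?expR_ge0 //; apply: le_trans (expR_ge1Dx u).
  by rewrite lerDr.
apply: le_trans h1; rewrite /u -natr1.
have B0 : 0 <= B by rewrite /B; lra.
have h2 : (n%:R + 1) * B <= 2 * n%:R * B by rewrite ler_wpM2r //; lra.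
have n0 : 0 <= n%:R :> R by [].
have h3 := ler_wpM2l n0 nB.
have -> : (sigma * n%:R / 2) ^+ 2 = n%:R * (sigma ^+ 2 * n%:R) / 4 by field.
lra.
Qed.

(** * The zero set *)

(* The midpoint of the k-th of the K intervals of length 2 / K that tile [-1, 1]. *)
Definition tile {R : realType} (K k : nat) : R := -1 + (2 * k%:R + 1) / K%:R.

Lemma tile_bounds (R : realType) (K k : nat) : (k < K)%N ->
  -1 <= tile K k - K%:R^-1 :> R /\ tile K k + K%:R^-1 <= 1 :> R.
Proof.
move=> kK; have K0 : 0 < K%:R :> R by rewrite ltr0n (leq_trans _ kK).
have -> : tile K k - K%:R^-1 = -1 + 2 * (k%:R / K%:R) :> R by rewrite /tile; field; rewrite gt_eqF.
have -> : tile K k + K%:R^-1 = -1 + 2 * (k.+1%:R / K%:R) :> R.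
  by rewrite /tile -natr1; field; rewrite gt_eqF.
have : 0 <= k%:R / K%:R :> R by rewrite divr_ge0.
have : k.+1%:R / K%:R <= 1 :> R by rewrite ler_pdivrMr // mul1r ler_nat.
by move=> *; split; lra.
Qed.

Lemma tile_next (R : realType) (K k : nat) : tile K k + K%:R^-1 = tile K k.+1 - K%:R^-1 :> R.
Proof. by rewrite /tile -natr1; ring. Qed.

Lemma tile_first (R : realType) (K : nat) : tile K 0 - K%:R^-1 = -1 :> R.
Proof. by rewrite /tile; ring. Qed.

Lemma tile_last (R : realType) (K : nat) : tile K.+1 K + K.+1%:R^-1 = 1 :> R.
Proof. by rewrite /tile -(natr1 K); field; rewrite natr1 pnatr_eq0. Qed.

Lemma tile_cover (R : realType) (K : nat) (x : R) : -1 <= x <= 1 ->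
  exists2 k, (k < K.+1)%N & tile K.+1 k - K.+1%:R^-1 <= x <= tile K.+1 k + K.+1%:R^-1.
Proof.
move=> /andP[x1 x2].
suff H m : x <= tile K.+1 m + K.+1%:R^-1 ->
    exists2 k, (k < m.+1)%N & tile K.+1 k - K.+1%:R^-1 <= x <= tile K.+1 k + K.+1%:R^-1.
  by apply: H; rewrite tile_last.
elim: m => [|m IH] xm; first by exists 0%N => //; rewrite tile_first x1.
have [le|lt] := leP x (tile K.+1 m + K.+1%:R^-1).
  by have [k km kx] := IH le; exists k => //; exact: leqW.
by exists m.+1 => //; rewrite xm andbT -tile_next ltW.
Qed.

Lemma tile_pigeonhole (R : realType) (E : set R) (K : nat) (delta : R) :
  measurable E -> E `<=` `[-1, 1] -> (delta%:E <= lebesgue_measure E)%E ->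
  exists2 k, (k < K.+1)%N & ((delta / K.+1%:R)%:E <= lebesgue_measure
    (E `&` `[(tile K.+1 k - K.+1%:R^-1)%R, (tile K.+1 k + K.+1%:R^-1)%R]))%E.
Proof.
move=> mE E1 dE; apply: contrapT => H.
have {}H k : (k < K.+1)%N -> (lebesgue_measure (E `&`
    `[(tile K.+1 k - K.+1%:R^-1)%R, (tile K.+1 k + K.+1%:R^-1)%R]) < (delta / K.+1%:R)%:E)%E.
  by move=> kK; rewrite ltNge; apply/negP => h; apply: H; exists k.
have mI a b : measurable (E `&` `[a, b] : set R) by apply: measurableI.
(* Adding the strict bounds tile by tile up to the last one contradicts the lower bound [delta]. *)
have P k : (k < K.+1)%N -> (lebesgue_measure (E `&` `[(-1)%R, (tile K.+1 k + K.+1%:R^-1)%R])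
    < (k.+1%:R * (delta / K.+1%:R))%:E)%E.
  elim: k => [|k IH] kK; first by have := H 0%N kK; rewrite tile_first mul1r.
  rewrite -(natr1 k.+1) mulrDl mul1r EFinD.
  apply: le_lt_trans _ (lteD (IH (ltnW kK)) (H k.+1 kK)).
  apply: le_trans _ (measureU2 lebesgue_measure (mI _ _) (mI _ _)).
  apply: le_measure; rewrite ?inE; [exact: mI | exact: measurableU (mI _ _) (mI _ _) | ].
  move=> x [Ex /=]; rewrite in_itv /= => /andP[x1 x2].
  have [le|lt] := leP x (tile K.+1 k + K.+1%:R^-1).
    by left; split => //=; rewrite in_itv /= x1.
  by right; split => //=; rewrite in_itv /= x2 andbT -tile_next ltW.
have := P K (ltnSn K); rewrite tile_last setIidl //.
have -> : K.+1%:R * (delta / K.+1%:R) = delta by rewrite mulrC divfK // pnatr_eq0.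
by rewrite ltNge dE.
Qed.

Lemma measure_segment_le2 (R : realType) (E : set R) : measurable E -> E `<=` `[-1, 1] ->
  (lebesgue_measure E <= 2%:E)%E.
Proof.
move=> mE E1; apply: (@le_trans _ _ (lebesgue_measure (`[-1, 1] : set R))).
  by apply: le_measure; rewrite ?inE.
rewrite lebesgue_measure_itv /= lte_fin (_ : (-1 < 1 :> R)%R = true); last by lra.
by rewrite -EFinB lee_fin; lra.
Qed.

Lemma measure_segment_fin (R : realType) (E : set R) : measurable E -> E `<=` `[-1, 1] ->
  lebesgue_measure E = (fine (lebesgue_measure E))%:E.
Proof.
move=> mE E1; rewrite fineK // ge0_fin_numE ?measure_ge0 //.
exact: le_lt_trans (measure_segment_le2 R E mE E1) (ltry _).
Qed.

(* Bernstein quasianalyticity: a zero set of positive measure forces zeros on a whole tile,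
   and then on the neighbouring tiles one after the other. *)
Lemma zero_set_null (R : realType) (f : R -> R) (kappa : R) :
  {within `[-1, 1], continuous f} -> (exists2 x : R, x \in `[-1, 1] & f x != 0) ->
  0 < kappa <= 1 ->
  (forall N, exists2 n, (N <= n)%N & bestapprox f n <= expR (- (kappa * n%:R))) ->
  lebesgue_measure ([set x | `|f x| <= 0] `&` `[-1, 1]) = 0%E.
Proof.
move=> hf [x0 x0i fx0] k01 hN; set Z := [set x | `|f x| <= 0].
have t01 : 0 < (1 : R) <= 1 by rewrite ltr01 lexx.
have [sigma [rho [N0 [s0 r0 H]]]] := level_propagation R f kappa 1 hf k01 t01.
have mZ a b : -1 <= a -> b <= 1 -> measurable (Z `&` `[a, b]) by apply: measurable_sublevel.
have ZI : Z `&` `[-1, 1] `<=` `[-1, 1] by apply: subIsetr.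
have muE := measure_segment_fin R _ (mZ _ _ (lexx _) (lexx _)) ZI.
have mu2 := measure_segment_le2 R _ (mZ _ _ (lexx _) (lexx _)) ZI.
apply/eqP; rewrite eq_le measure_ge0 andbT leNgt; apply/negP => Zpos.
move: Zpos mu2; rewrite muE; set z := fine _; rewrite lte_fin lee_fin => z0 z2.
(* The density [expR (- L)] is at most [z / 4], as for the tile found by pigeonhole, and at most 1/2
   because [z <= 2], as for a zero tile inside an interval twice as long. *)
pose L := Num.max 3 (- ln (z / 4)).
have L3 : 3 <= L by rewrite le_max lexx.
have Lz : expR (- L) <= z / 4.
  rewrite -[leRHS]lnK ?posrE ?divr_gt0 // ler_expR lerNl le_max lexx orbT //.
have eL0 := expR_gt0 (- L).
(* Zeros lie in every sublevel set, so the local estimate holds for arbitrarily large [n] and forces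
   [f x = 0]. *)
have step c h : -1 <= c - h -> c + h <= 1 -> 0 < h -> 4 * h / rho <= expR (- L) ->
    ((2 * h * expR (- L))%:E <= lebesgue_measure (Z `&` `[(c - h)%R, (c + h)%R]))%E ->
    forall x, c - h <= x <= c + h -> f x = 0.
  move=> c1 c2 h0 hr muh x xch; apply/eqP; apply: contraT; rewrite -normr_gt0 => fx.
  have [n Nn fn] := hN (maxn N0 (Num.truncn (sigma * `|f x|)^-1).+1).
  move: Nn; rewrite geq_max => /andP[N0n Nn].
  have := H n N0n fn c h L c1 c2 h0 L3; rewrite mul1r => /(_ hr _ x xch) fxn.
  suff : expR (- (sigma * n%:R)) < `|f x|.
    rewrite ltNge fxn //; apply: le_trans muh _; apply: le_measure; rewrite ?inE.
    - exact: mZ.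
    - exact: measurable_sublevel.
    - move=> y [/= fy yc]; split => //=; exact: le_trans fy (expR_ge0 _).
  rewrite expRN -[ltRHS]invrK ltf_pV2 ?posrE ?expR_gt0 ?invr_gt0 //.
  apply: lt_le_trans (expR_ge1Dx _).
  have : (sigma * `|f x|)^-1 < n%:R by apply: lt_le_trans (truncnS_gt _) _; rewrite ler_nat.
  rewrite invfM -(ltr_pM2l s0) mulVKf ?gt_eqF //; lra.
pose K := Num.truncn (8 / (rho * expR (- L))); pose h : R := K.+1%:R^-1.
have K0 : 0 < K.+1%:R :> R by rewrite ltr0n.
have h0 : 0 < h by rewrite invr_gt0.
have re : 0 < rho * expR (- L) by rewrite mulr_gt0.
(* 8 rather than 4, because propagation uses intervals of half-length [2 h]. *)
have h8 : 8 * h / rho <= expR (- L).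
  have hK : 8 <= K.+1%:R * (rho * expR (- L)).
    by rewrite -ler_pdivrMr //; apply: ltW; exact: truncnS_gt.
  rewrite ler_pdivrMr // /h ler_pdivrMr //.
  by rewrite (_ : _ * _ * _ = K.+1%:R * (rho * expR (- L))) //; ring.
have h4 : 4 * h / rho <= expR (- L).
  by apply: le_trans h8; rewrite ler_pdivrMr // divfK ?gt_eqF //; lra.
pose zero_on k := forall x, tile K.+1 k - h <= x <= tile K.+1 k + h -> f x = 0.
have [k0 k0K muk0] := tile_pigeonhole R _ K z (mZ _ _ (lexx _) (lexx _)) ZI
  (eq_ind _ (fun m => (m <= _)%E) (lexx _) _ muE).
have zk0 : zero_on k0.
  have [b1 b2] := tile_bounds R K.+1 k0 k0K.
  apply: step => //; apply: le_trans _ (le_trans muk0 _).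
    by rewrite lee_fin -/h mulrC mulrA ler_pM2r //; lra.
  by apply: le_measure; rewrite ?inE; [apply: measurableI => //; exact: mZ|exact: mZ|move=> y [[]]].
have grow k : (k.+1 < K.+1)%N -> forall j, (j = k \/ j = k.+1) -> zero_on j ->
    zero_on k /\ zero_on k.+1.
  move=> kK j jk zj.
  have [b1 _] := tile_bounds R K.+1 k (ltnW kK).
  have [_ b2] := tile_bounds R K.+1 k.+1 kK.
  have nx := tile_next R K.+1 k; rewrite -/h in b1 b2 nx.
  (* Two adjacent tiles form one interval centred at their common endpoint, half of it filled by
     zeros. *)
  have all0 : forall x, (tile K.+1 k + h) - 2 * h <= x <= (tile K.+1 k + h) + 2 * h -> f x = 0.
    apply: step; rewrite ?mulr_gt0 //; [lra|lra|by rewrite mulrA -natrM|].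
    apply: (@le_trans _ _ (lebesgue_measure (`[(tile K.+1 j - h)%R, (tile K.+1 j + h)%R] : set R))).
      rewrite lebesgue_measure_itv /= lte_fin (_ : (tile K.+1 j - h < tile K.+1 j + h)%R = true); last by lra.
      by rewrite -EFinB lee_fin; nra.
    apply: le_measure; rewrite ?inE //; first by apply: mZ; lra.
    move=> y yj; split => /=.
      by rewrite /Z /= zj ?normr0 //; move: yj; rewrite /= in_itv.
    move: yj; rewrite /= !in_itv /=; case: jk => ->; lra.
  by split => x xk; apply: all0; lra.
(* Descend to the leftmost tile first, then climb through all of them. *)
have z00 : zero_on 0%N.
  elim: k0 k0K zk0 {muk0} => [|k IH] kK // zk.
  by apply: IH (ltnW kK) _; have [] := grow k kK k.+1 (or_intror erefl) zk.
have zall k : (k < K.+1)%N -> zero_on k.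
  elim: k => [|k IH] kK //.
  by have [] := grow k kK k (or_introl erefl) (IH (ltnW kK)).
have [k kK kx] := @tile_cover R K x0 ltac:(by move: x0i; rewrite in_itv).
by move: fx0; rewrite (zall k kK x0 kx) eqxx.
Qed.

(** * Comparison of consecutive levels *)

Lemma distrib_m_mono (R : realType) (f : R -> R) (s t : R) :
  {within `[-1, 1], continuous f} -> s <= t -> (distrib_m f s <= distrib_m f t)%E.
Proof.
move=> hf st; apply: le_measure; rewrite ?inE; [exact: measurable_sublevel..|].
by move=> x [/= fx xi]; split => //=; exact: le_trans fx st.
Qed.

(** Continuity of the measure from above: the sublevel sets decrease to the zero set, which is null
    by [zero_set_null]. *)
Lemma distrib_m_small (R : realType) (f : R -> R) (kappa e : R) (n : nat -> nat) :
  {within `[-1, 1], continuous f} -> (exists2 x : R, x \in `[-1, 1] & f x != 0) ->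
  0 < kappa <= 1 -> (forall j, (n j < n j.+1)%N) ->
  (forall j, bestapprox f (n j) <= expR (- (kappa * (n j)%:R))) -> 0 < e ->
  \forall j \near \oo, (distrib_m f (expR (- (kappa * (n j)%:R))) < e%:E)%E.
Proof.
move=> hf hnz k01 hn hE e0; have /andP[k0 _] := k01.
have nj j : (j <= n j)%N by elim: j => // j IH; exact: leq_ltn_trans IH (hn j).
have nmono : {homo n : i j / (i <= j)%N}.
  by apply: homo_leq => // [i j k ij jk|i]; [exact: leq_trans ij jk|exact: ltnW].
pose F j : set R := [set x | `|f x| <= expR (- (kappa * (n j)%:R))] `&` `[-1, 1].
have mF j : measurable (F j) by exact: measurable_sublevel.
have FZ : \bigcap_j F j = [set x | `|f x| <= 0] `&` `[-1, 1].
  apply/seteqP; split => x.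
    move=> Fx; split; last by have [] := Fx 0%N I.
    rewrite /= leNgt; apply/negP => fx.
    pose j := (Num.truncn (kappa * `|f x|)^-1).+1.
    have [/= fj _] := Fx j I.
    suff : expR (- (kappa * (n j)%:R)) < `|f x| by rewrite ltNge fj.
    rewrite expRN -[ltRHS]invrK ltf_pV2 ?posrE ?expR_gt0 ?invr_gt0 //.
    apply: lt_le_trans (expR_ge1Dx _).
    have : (kappa * `|f x|)^-1 < (n j)%:R.
      by apply: lt_le_trans (truncnS_gt _) _; rewrite ler_nat.
    rewrite invfM -(ltr_pM2l k0) mulVKf ?gt_eqF //; lra.
  by move=> [/= fx xi] j _; split => //=; exact: le_trans fx (expR_ge0 _).
have Z0 := zero_set_null R f kappa hf hnz k01 (fun N => ex_intro2 _ _ (n N) (nj N) (hE N)).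
have cv := @nonincreasing_cvg_mu _ _ _ (@lebesgue_measure R) F.
have Fdec : {homo F : i j / (i <= j)%N >-> (j <= i)%O}.
  move=> i j ij; apply/subsetPset => x [/= fx xi]; split => //=; apply: le_trans fx _.
  by rewrite ler_expR lerN2 ler_pM2l // ler_nat nmono.
have FI j : F j `<=` `[-1, 1] by apply: subIsetr.
have F0 : (lebesgue_measure (F 0%N) < +oo)%E.
  exact: le_lt_trans (measure_segment_le2 R _ (mF 0%N) (FI 0%N)) (ltry _).
have mI : measurable (\bigcap_j F j) by exact: bigcapT_measurable.
have := cv F0 mF mI Fdec; rewrite FZ [X in _ --> X]Z0 => h.
exact: h _ (nbhs_open_ereal_lt (f := fun=> e) e0).
Qed.

Lemma bestapprox_star_le (R : realType) (f : R -> R) (kappa : R) (n : nat) : kappa <= 1 ->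
  bestapprox f n <= expR (- (kappa * n%:R)) -> bestapprox_star f n <= expR (- (kappa * n%:R)).
Proof.
move=> k1 fn; rewrite /bestapprox_star ge_max fn /= ler_expR lerN2.
by rewrite -[leRHS]mul1r ler_wpM2r.
Qed.

(** The measure [m1] may exceed 1; then its logarithm is at most [ln 2], and [1 <= 2 * theta * l]
    covers that side of the absolute value. *)
Lemma abslog_le (R : realType) (M theta l : R) (m1 m2 : \bar R) :
  0 <= M -> 2 * theta * M <= 1 -> 1 <= 2 * theta * l -> 0 <= l -> (m2 = (expR (- l))%:E) ->
  ((expR (- (2 * theta * l)))%:E <= m1 <= 2%:E)%E ->
  (M%:E * abslog m1 <= abslog m2)%E.
Proof.
move=> M0 tM tl l0 -> /andP[]; case: m1 => [r| |] //; rewrite !lee_fin => r1 r2.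
have r0 : 0 < r by apply: lt_le_trans r1; exact: expR_gt0.
rewrite /abslog !eqe !gt_eqF ?expR_gt0 //= expRK normrN (ger0_norm l0) -EFinM lee_fin.
have h1 : - (2 * theta * l) <= ln r by rewrite -[leLHS]expRK ler_ln ?posrE ?expR_gt0.
have h2 : ln r <= 1.
  rewrite -[leRHS]expRK ler_ln ?posrE ?expR_gt0 //; apply: le_trans r2 _.
  by have := expR_ge1Dx (1 : R).
have h3 : `|ln r| <= 2 * theta * l by rewrite ler_norml h1 /=; lra.
apply: le_trans (ler_wpM2l M0 h3) _.
have -> : M * (2 * theta * l) = 2 * theta * M * l by ring.
by rewrite -[leRHS]mul1r ler_wpM2r.
Qed.

(** Some tile is filled with density at least half the measure of the small sublevel set, and by
    [level_propagation] that whole tile lies in the coarser one. *)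
Lemma distrib_m_power (R : realType) (f : R -> R) (kappa theta : R) :
  {within `[-1, 1], continuous f} -> 0 < kappa <= 1 -> 0 < theta <= 1 ->
  exists sigma l0 : R, exists N0 : nat, 0 < sigma /\
    forall (n : nat) (l : R), (N0 <= n)%N -> l0 <= l ->
      bestapprox f n <= expR (- (kappa * n%:R)) ->
      ((expR (- l))%:E <= distrib_m f (expR (- (kappa * n%:R))))%E ->
      ((expR (- (2 * theta * l)))%:E <= distrib_m f (expR (- (sigma * n%:R))))%E.
Proof.
move=> hf k01 t01; have /andP[t0 t1] := t01.
have [sigma [rho [N0 [s0 r0 H]]]] := level_propagation R f kappa theta hf k01 t01.
exists sigma, (3 + 4 / (rho * theta)), N0; split=> // n l N0n l0l fn muE.
have rt0 : 0 < 4 / (rho * theta) by rewrite divr_gt0 // mulr_gt0.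
have ln2_gt0 : 0 <= ln 2 :> R by rewrite ln_ge0; lra.
have ln2_le1 : ln 2 <= 1 :> R.
  by rewrite -[leRHS]expRK ler_ln ?posrE ?expR_gt0 //; have := expR_ge1Dx (1 : R).
(* A tile has length [2 h] but pigeonhole yields measure [h * expR (- l)], hence the loss of a
   factor 2. *)
pose L := l + ln 2.
have eL : expR (- L) = expR (- l) / 2 by rewrite /L opprD expRD [expR (- ln 2)]expRN lnK ?posrE.
(* [y] is the least value of [1 / h] compatible with [hrho]. *)
pose y := 4 / rho * expR (theta * L); pose K := Num.truncn y; pose h : R := K.+1%:R^-1.
have y0 : 0 <= y by rewrite mulr_ge0 ?expR_ge0 // divr_ge0 // ltW.
have K0 : 0 < K.+1%:R :> R by rewrite ltr0n.
have h0 : 0 < h by rewrite invr_gt0.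
pose E := [set x | `|f x| <= expR (- (kappa * n%:R))] `&` `[-1, 1].
have mE : measurable E by exact: measurable_sublevel.
have [k kK muk] := tile_pigeonhole R E K _ mE (@subIsetr _ _ _) muE.
have [b1 b2] := tile_bounds R K.+1 k kK; rewrite -/h in muk b1 b2.
have L3 : 3 <= L by rewrite /L; lra.
have hrho : 4 * h / rho <= expR (- (theta * L)).
  rewrite expRN ler_pdivrMr // ler_pdivlMl ?expR_gt0 // /h mulrA ler_pdivrMr //.
  apply: ltW; have := truncnS_gt y; rewrite -/K -(ltr_pM2l r0) => yK.
  apply: le_lt_trans yK; rewrite le_eqVlt; apply/orP; left; apply/eqP.
  by rewrite /y; field; rewrite gt_eqF.
have small : forall x, tile K.+1 k - h <= x <= tile K.+1 k + h -> `|f x| <= expR (- (sigma * n%:R)).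
  apply: (H n N0n fn _ _ L b1 b2 h0 L3 hrho); apply: le_trans _ (le_trans muk _).
    by rewrite lee_fin eL /h le_eqVlt; apply/orP; left; apply/eqP; field; rewrite gt_eqF.
  apply: le_measure; rewrite ?inE; [exact: measurableI|exact: measurable_sublevel|].
  by move=> x [[]].
apply: (@le_trans _ _ (lebesgue_measure (`[(tile K.+1 k - h)%R, (tile K.+1 k + h)%R] : set R))).
  rewrite lebesgue_measure_itv /= lte_fin (_ : (tile K.+1 k - h < tile K.+1 k + h)%R = true); last by lra.
  rewrite -EFinB lee_fin (_ : _ - _ = 2 * h); last by ring.
  rewrite expRN -[2 * h]invrK lef_pV2 ?posrE ?expR_gt0 ?invr_gt0 ?mulr_gt0 //.
  rewrite invfM /h invrK mulrC ler_pdivrMr //.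
  have yK : K.+1%:R <= y + 1.
    by rewrite -natr1 lerD2r; have /andP[] := truncn_itv y0.
  set w := expR (2 * theta * l).
  have w1 : 1 <= w by rewrite -[leLHS]expR0 ler_expR !mulr_ge0 // ?(ltW t0) //; lra.
  suff : y <= w by lra.
  (* The exponent [2 theta] in place of [theta] leaves the first factor free to absorb [4 / rho], by
     the choice of [l0]. *)
  have -> : w = expR (theta * (l - ln 2)) * expR (theta * L).
    by rewrite /w /L -expRD; congr expR; ring.
  rewrite /y ler_pM2r ?expR_gt0 //; apply: le_trans (expR_ge1Dx _).
  have -> : 4 / rho = theta * (4 / (rho * theta)) by field; rewrite !gt_eqF.
  have : theta * (4 / (rho * theta)) <= theta * (l - ln 2) by rewrite ler_pM2l //; lra.
  lra.
apply: le_measure; rewrite ?inE //; first exact: measurable_sublevel.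
move=> x; rewrite /= !in_itv /= => xk; split; first exact: small.
by move: xk b1 b2; lra.
Qed.

Theorem theoremA (R : realType) (f : R -> R)
  (hf : {within `[-1, 1]%classic, continuous f})
  (hnz : exists2 x : R, x \in `[-1, 1] & f x != 0)
  (beta : R) (hbeta : 0 < beta) (n : nat -> nat)
  (hn : forall j, (n j < n j.+1)%N)
  (hlac : (fun j => (n j.+1)%:R / (n j)%:R : R) @ \oo --> +oo)
  (hE : forall j, bestapprox f (n j) <= expR (- beta * (n j)%:R)) :
  forall M : R, 0 < M ->
    \forall j \near \oo,
      (M%:E * abslog (distrib_m f (bestapprox_star f (n j)))
        <= abslog (distrib_m f (bestapprox_star f (n j.+1))))%E.
Proof.
(* The cap at 1 makes [expR (- n)] at most [expR (- kappa n)], so that [bestapprox_star] obeys the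
   same bound. *)
move=> M M0; pose kappa := Num.min beta 1.
have k01 : 0 < kappa <= 1 by rewrite lt_min hbeta ltr01 ge_min lexx orbT.
have k1 : kappa <= 1 by case/andP: k01.
have {}hE j : bestapprox f (n j) <= expR (- (kappa * (n j)%:R)).
  apply: le_trans (hE j) _; rewrite ler_expR mulNr lerN2 ler_wpM2r //.
  by rewrite ge_min lexx.
(* The power [2 theta] of the next measure then gives a ratio of logarithms of at least [M]. *)
pose theta := Num.min 1 (2 * M)^-1.
have t01 : 0 < theta <= 1 by rewrite lt_min ltr01 invr_gt0 mulr_gt0 //= ge_min lexx.
have /andP[t0 t1] := t01.
have tM : 2 * theta * M <= 1.
  have : theta <= (2 * M)^-1 by rewrite ge_min lexx orbT.
  by rewrite -[X in _ <= X]mul1r ler_pdivlMr ?mulr_gt0 // => tM; lra.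
have [sigma [l0 [N0 [s0 H]]]] := distrib_m_power R f kappa theta hf k01 t01.
pose l1 := Num.max l0 (2 * theta)^-1.
have e1 := expR_gt0 (- l1).
have [J1 _ small] := distrib_m_small R f kappa _ n hf hnz k01 hn hE e1.
(* Lacunarity gives [n j <= sigma * n j.+1], so level [expR (- sigma n_(j+1))] lies below
   [expR (- n_j)]. *)
have [J2 _ lac] := (cvgryPge _).1 hlac sigma^-1.
have nj j : (j <= n j)%N by elim: j => // j IH; exact: leq_ltn_trans IH (hn j).
exists (maxn J1 (maxn J2 N0)) => // j /=; rewrite !geq_max => /and3P[jJ1 jJ2 jN0].
set m1 := distrib_m f (bestapprox_star f (n j)).
set m2 := distrib_m f (bestapprox_star f (n j.+1)).
have mS t : measurable ([set x | `|f x| <= t] `&` `[-1, 1]) by exact: measurable_sublevel.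
have mfin t : distrib_m f t = (fine (distrib_m f t))%:E.
  by apply: measure_segment_fin (mS t) _; apply: subIsetr.
have m20 : (0 <= m2)%E by exact: measure_ge0.
have [m2z|m2nz] := eqVneq m2 0%E; first by rewrite {2}/abslog m2z eqxx leey.
have star j' : bestapprox_star f (n j') <= expR (- (kappa * (n j')%:R)).
  by apply: bestapprox_star_le.
have m2le : (m2 <= distrib_m f (expR (- (kappa * (n j.+1)%:R))))%E.
  by apply: distrib_m_mono.
have m2s : (m2 < (expR (- l1))%:E)%E.
  by apply: le_lt_trans m2le _; apply: small; rewrite /= leqW.
have d0 : 0 < fine m2 by rewrite -lte_fin -mfin lt_def m2nz.
pose l := - ln (fine m2).
have m2E : m2 = (expR (- l))%:E by rewrite /l opprK lnK ?posrE // -mfin.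
have ll1 : l1 <= l by move: m2s; rewrite m2E lte_fin ltr_expR ltrN2 => /ltW.
have ll0 : l0 <= l by apply: le_trans ll1; rewrite le_max lexx.
have tl : 1 <= 2 * theta * l.
  have : (2 * theta)^-1 <= l by apply: le_trans ll1; rewrite le_max lexx orbT.
  by rewrite -[X in X <= _]mul1r ler_pdivrMr ?mulr_gt0 // mulrC.
have lp : 0 <= l by rewrite -(pmulr_rge0 _ (_ : 0 < 2 * theta)) ?mulr_gt0 //; lra.
apply: (@abslog_le R M theta l) => //; first exact: ltW.
apply/andP; split; last by apply: measure_segment_le2 (mS _) _; apply: subIsetr.
have Nn : (N0 <= n j.+1)%N by apply: leq_trans jN0 (leq_trans (leqnSn j) (nj _)).
apply: le_trans (H _ l Nn ll0 (hE j.+1) _) _; first by rewrite -m2E.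
(* The floor [expR (- n_j)] in [bestapprox_star] makes the level at index [j] large enough. *)
apply: distrib_m_mono => //; rewrite /bestapprox_star le_max; apply/orP; right.
rewrite ler_expR lerN2; have := lac j jJ2 => /= lacj.
(* For [n j = 0] the ratio is a division by zero, but the inequality is trivial. *)
have [nj0|njp] := posnP (n j); first by rewrite nj0 mulr_ge0 // ltW.
move: lacj; rewrite ler_pdivlMr ?ltr0n // => lacj.
by rewrite -ler_pdivrMl.
Qed.
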